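(* Let $K$ be a number field, let $n \geq 2$, and let $D$ be the divisor on $\mathbb{P}^n_K$ \[ D = H_1 + \dots + H_{n-1} + Q, \] where $H_1,\dots,H_{n-1}\subset\mathbb{P}^n_K$ are hyperplanes defined over $K$ in general position and $Q\subset \mathbb{P}^n_K$ is a smooth quadric hypersurface defined over $K$. Suppose that the line $L := H_1\cap\dots\cap H_{n-1}$ meets $Q$ in two distinct $K$-rational points. Then the integral points on $\mathbb{P}^n_K\setminus D$ are potentially dense.
   Context: Let $K$ be a number field and $S$ a finite set of places of $K$ containing all archimedean places; $\mathcal{O}_S=\{x\in K: v(x)\ge 0 \text{ for all finite } v\notin S\}$. For a finite place $v$, $\mathcal{O}_v$ is the valuation ring, $\mathfrak{m}_v$ its maximal ideal and $k_v$ its residue field. Reduction: for a closed subvariety $Z\subset\mathbb{P}^n_K$ with radical homogeneous ideal $I\subset K[X_0,\dots,X_n]$, $Z_v\subset\mathbb{P}^n_{k_v}$ is the zero set of the image of $I\cap\mathcal{O}_v[X_0,\dots,X_n]$ in $k_v[X_0,\dots,X_n]$. For $x\in\mathbb{P}^n(K)$, $x_v\in\mathbb{P}^n(k_v)$ is its reduction (choose coordinates in $\mathcal{O}_v$ not all in $\mathfrak{m}_v$ and reduce mod $\mathfrak{m}_v$); $x$ reduces to $Z$ at $v$ if $x_v\in Z_v$. For a quasi-projective $X\subset\mathbb{P}^n_K$ with Zariski closure $\widetilde X$ and a proper closed subvariety $D\subset X$ (divisors are identified with their supports), $x\in X(K)$ is an $S$-integral point of $X\setminus D$ if for every finite place $v\notin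 S$, $x$ does not reduce to $D\cup(\widetilde X\setminus X)$ at $v$; the set of these is $(X\setminus D)(\mathcal{O}_S)$. For $X$ projective, the integral points on $X\setminus D$ are potentially dense if there exist a finite extension $K'/K$ and a finite set $S'$ of places of $K'$ containing all places above those of $S$ (and all archimedean places) such that $(X\setminus D)(\mathcal{O}_{S'})$, computed over $K'$, is Zariski dense in $X_{K'}$. *)

(* Defs.v *)
From HB Require Import structures.
From mathcomp Require Import all_boot all_order all_algebra all_field.
From mathcomp Require Import mpoly.
From Stdlib Require List.

Set Implicit Arguments.
Unset Strict Implicit.
Unset Printing Implicit Defensive.

Import Order.TTheory GRing.Theory Num.Theory.
Local Open Scope ring_scope.

(* Finite places of a field K, represented by their unique normalized
   (surjective onto Z) discrete valuation v : K -> int; convention v 0 = 0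
   (the value at 0 is irrelevant and is fixed so that each place has exactly
   one representative function). *)
Definition is_fin_place (K : fieldType) (v : K -> int) : Prop :=
  [/\ v 0 = 0,
      (forall a b : K, a != 0 -> b != 0 -> v (a * b) = v a + v b),
      (forall a b : K, a != 0 -> b != 0 -> a + b != 0 ->
          Num.min (v a) (v b) <= v (a + b))
    & exists a : K, v a = 1].

Definition in_Ov (K : fieldType) (v : K -> int) (a : K) : bool :=
  (a == 0) || (0 <= v a).
Definition in_mv (K : fieldType) (v : K -> int) (a : K) : bool :=
  (a == 0) || (0 < v a).

(* The place w of L lies above the place v of K (via the embedding s):
   the restriction of w to K is equivalent to v (same valuation ring). *)
Definition lies_above (K L : fieldType) (s : {rmorphism K -> L})
    (w : L -> int) (v : K -> int) : Prop :=
  forall a : K, in_Ov v a = in_Ov w (s a).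

Definition homogeneous (K : fieldType) (N : nat) (g : {mpoly K[N]}) : Prop :=
  exists d : nat, g \is d.-homog.

(* Points of P^n(K) are given by nonzero coordinate vectors 'I_(n+1) -> K. *)
Definition nonzero_pt (K : fieldType) (N : nat) (x : 'I_N -> K) : Prop :=
  exists i, x i != 0.

Definition proportional (K : fieldType) (N : nat) (x y : 'I_N -> K) : Prop :=
  exists c : K, forall i, x i = c * y i.

(* The radical of the principal ideal (F) of K[X_0..X_n]: this is the radical
   homogeneous ideal of the hypersurface V(F) (Nullstellensatz). *)
Definition in_rad (K : fieldType) (N : nat) (F f : {mpoly K[N]}) : Prop :=
  exists (m : nat) (g : {mpoly K[N]}), f ^+ m = F * g.

(* x reduces at v to the closed subvariety Z = V(F) with ideal I = rad (F):
   take coordinates c*x in O_v, not all in m_v; the reduction lies in the zero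
   set of the image of I ∩ O_v[X] in k_v[X] (tested on its homogeneous
   elements, I being homogeneous), i.e. every homogeneous g in I with
   coefficients in O_v satisfies g(c x) in m_v. *)
Definition reduces_to (K : fieldType) (N : nat) (v : K -> int)
    (F : {mpoly K[N]}) (x : 'I_N -> K) : Prop :=
  exists c : K,
    [/\ c != 0,
        (forall i, in_Ov v (c * x i)),
        (exists i, ~~ in_mv v (c * x i))
      & forall g : {mpoly K[N]}, in_rad F g -> homogeneous g ->
          (forall m, in_Ov v g@_m) ->
          in_mv v (g.@[fun i => c * x i])].

(* S-integral points of P^n \ V(F), where S is given by its finite places
   (archimedean places are always in S; they play no role in O_S). *)
Definition integral_point (K : fieldType) (N : nat) (S : seq (K -> int))
    (F : {mpoly K[N]}) (x : 'I_N -> K) : Prop :=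
  nonzero_pt x /\
  forall v, is_fin_place v -> ~ List.In v S -> ~ reduces_to v F x.

Definition potentially_dense (K : fieldExtType rat) (N : nat)
    (S : seq (K -> int)) (F : {mpoly K[N]}) : Prop :=
  exists (L : fieldExtType rat) (s : {rmorphism K -> L}) (S' : seq (L -> int)),
    [/\ (forall w, List.In w S' -> is_fin_place w),
        (forall w, is_fin_place w ->
            (exists2 v, List.In v S & lies_above s w v) -> List.In w S')
      & forall g : {mpoly L[N]}, homogeneous g ->
          (forall x, integral_point S' (map_mpoly s F) x -> g.@[x] = 0) ->
          g = 0].

Definition linform (K : fieldType) (k N : nat) (H : 'M[K]_(k, N)) (i : 'I_k)
  : {mpoly K[N]} := \sum_(j < N) H i j *: 'X_j.

Definition quadform (K : fieldType) (N : nat) (A : 'M[K]_N) : {mpoly K[N]} :=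
  \sum_(i < N) \sum_(j < N) A i j *: ('X_i * 'X_j).

Definition divisor_eq (K : fieldType) (k N : nat) (H : 'M[K]_(k, N))
    (A : 'M[K]_N) : {mpoly K[N]} :=
  (\prod_(i < k) linform H i) * quadform A.

Definition on_LQ (K : fieldType) (k N : nat) (H : 'M[K]_(k, N))
    (A : 'M[K]_N) (x : 'I_N -> K) : Prop :=
  (forall i, (linform H i).@[x] = 0) /\ (quadform A).@[x] = 0.

(* Main.v *)
Require Import Defs.
From HB Require Import structures.
From mathcomp Require Import all_boot all_order all_algebra all_field.
From mathcomp Require Import mpoly.
From mathcomp Require Import zify ring.
From Stdlib Require List.
From Stdlib Require Import Classical FunctionalExtensionality.
Import Order.TTheory GRing.Theory Num.Theory.
Local Open Scope ring_scope.

(* Choose coordinates (t, y, z) in which the hyperplanes are t_i = 0 and the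
   quadric is q(t) + 2b yz = 0. Given S-units t_i, y and u, solving
   q(t) + 2b yz = u for z gives an S-integral point once S contains the places
   dividing 2b or one of the finitely many coefficients involved; letting t_i, y
   and u run over the powers of 2 gives a dense set, already over K. Enlarging S
   in this way requires the support of an element of K^* to be finite. If
   v_1, ..., v_m are distinct places over p, choose w_i with v_i(w_i) < 0 and
   v_j(w_i) > 0 for j <> i; a nontrivial rational relation among the w_i would
   have a unique term of least v_i-value, for i minimizing the p-adic value of
   the i-th coefficient, so m <= [K : Q]. *)

(** * Discrete valuations *)

Section Place.
Variables (K : fieldType) (v : K -> int).
Hypothesis hv : is_fin_place v.

Lemma place0 : v 0 = 0. Proof. by case: hv. Qed.

Lemma placeM a b : a != 0 -> b != 0 -> v (a * b) = v a + v b.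
Proof. by case: hv => _ + _ _; apply. Qed.

Lemma place1 : v 1 = 0.
Proof. by have := placeM 1 1 (oner_neq0 _) (oner_neq0 _); rewrite mulr1; lia. Qed.

Lemma placeN a : v (- a) = v a.
Proof.
have [->|a0] := eqVneq a 0; first by rewrite oppr0.
have N1 : (-1 : K) != 0 by rewrite oppr_eq0 oner_neq0.
have vN1 : v (-1) = 0.
  by have := placeM (-1) (-1) N1 N1; rewrite mulrNN mulr1 place1; lia.
by rewrite -mulN1r placeM // vN1 add0r.
Qed.

Lemma placeV a : v a^-1 = - v a.
Proof.
have [->|a0] := eqVneq a 0; first by rewrite invr0 place0.
have := placeM a a^-1 a0; rewrite invr_eq0 divff // place1 => /(_ a0); lia.
Qed.

Lemma placeX a n : v (a ^+ n) = v a *+ n.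
Proof.
have [->|a0] := eqVneq a 0.
  by case: n => [|n]; rewrite ?expr0 ?place1 ?mulr0n // expr0n place0 mul0rn.
elim: n => [|n IHn]; first by rewrite expr0 place1.
by rewrite exprS placeM ?expf_neq0 // IHn mulrS.
Qed.

Lemma placeD a b : a != 0 -> b != 0 -> a + b != 0 -> Num.min (v a) (v b) <= v (a + b).
Proof. by case: hv => _ _ + _; apply. Qed.

(** If [a + b] had value above [v a], then so would [a = (a + b) - b]. The bound on [b] is guarded
    by [b != 0] because [v 0] is 0 by convention and not infinity. *)
Lemma placeD_lt a b : a != 0 -> (b != 0 -> v a < v b) ->
  a + b != 0 /\ v (a + b) = v a.
Proof.
have [->|b0] := eqVneq b 0; first by rewrite addr0.
move=> a0 /(_ isT) ab.
have s0 : a + b != 0.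
  by apply: contraTneq ab => /eqP; rewrite addr_eq0 => /eqP ->; rewrite placeN ltxx.
split=> //.
have h1 := placeD a b a0 b0 s0.
have := placeD (a + b) (- b) s0; rewrite addrK oppr_eq0 placeN => /(_ b0 a0).
by lia.
Qed.

Lemma place_gtD k a b : (a != 0 -> k < v a) -> (b != 0 -> k < v b) ->
  a + b != 0 -> k < v (a + b).
Proof.
have [-> _ kb|a0] := eqVneq a 0; first by rewrite add0r.
have [-> ka _|b0] := eqVneq b 0; first by rewrite addr0 => _; exact: ka.
move=> /(_ isT) ka /(_ isT) kb s0.
by apply: lt_le_trans (placeD a b a0 b0 s0); rewrite lt_min ka.
Qed.

(** A unique term of least value cannot be cancelled by the others. This is the tool for refuting
    linear relations over the rationals. *)
Lemma place_sum_neq0 (I : finType) (F : I -> K) i : F i != 0 ->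
  (forall j, j != i -> F j != 0 -> v (F i) < v (F j)) -> \sum_j F j != 0.
Proof.
move=> Fi0 lt_F; rewrite (bigD1 i) //=.
apply: (proj1 (placeD_lt _ _ Fi0 _)).
apply: (big_ind (fun x => x != 0 -> v (F i) < v x)) => //; first by rewrite eqxx.
exact: place_gtD.
Qed.

Lemma Ov0 : in_Ov v 0. Proof. by rewrite /in_Ov eqxx. Qed.

Lemma Ov1 : in_Ov v 1. Proof. by rewrite /in_Ov place1 lexx orbT. Qed.

Lemma OvN a : in_Ov v (- a) = in_Ov v a.
Proof. by rewrite /in_Ov oppr_eq0 placeN. Qed.

Lemma OvM a b : in_Ov v a -> in_Ov v b -> in_Ov v (a * b).
Proof.
have [->|a0] := eqVneq a 0; first by rewrite mul0r.
have [->|b0] := eqVneq b 0; first by rewrite mulr0.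
rewrite /in_Ov (negbTE a0) (negbTE b0) /= mulf_eq0 (negbTE a0) (negbTE b0) /=.
by rewrite placeM //; exact: addr_ge0.
Qed.

Lemma OvD a b : in_Ov v a -> in_Ov v b -> in_Ov v (a + b).
Proof.
have [->|a0] := eqVneq a 0; first by rewrite add0r.
have [->|b0] := eqVneq b 0; first by rewrite addr0.
have [->|s0] := eqVneq (a + b) 0; first by rewrite Ov0.
rewrite /in_Ov (negbTE a0) (negbTE b0) (negbTE s0) /= => va vb.
by apply: le_trans (placeD a b a0 b0 s0); rewrite le_min va.
Qed.

Lemma Ov_sum (I : finType) (F : I -> K) :
  (forall i, in_Ov v (F i)) -> in_Ov v (\sum_i F i).
Proof. by move=> OF; apply: (big_ind (in_Ov v)) => //; [exact: Ov0|exact: OvD]. Qed.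

Lemma Ov_nat n : in_Ov v n%:R.
Proof. by elim: n => [|n IHn]; rewrite ?Ov0 // mulrS OvD // Ov1. Qed.

Lemma Ov_int (z : int) : in_Ov v z%:~R.
Proof. by case: z => n; [exact: Ov_nat|rewrite NegzE mulrNz OvN; exact: Ov_nat]. Qed.

Lemma Ov_eq0 a : v a = 0 -> in_Ov v a.
Proof. by rewrite /in_Ov => ->; rewrite lexx orbT. Qed.

(** Strong induction on [n]: either the least prime divisor has nonzero value, or the cofactor has
    the same value as [n]. *)
Lemma place_natP n : v n%:R != 0 -> exists2 p, p \in primes n & v p%:R != 0.
Proof.
have [m] := ubnP n; elim: m n => // m IHm n.
have [n1|n1 n_le vn] := leqP n 1.
  by case: n n1 => [|[|//]] // _ _; rewrite ?place0 ?place1 eqxx.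
have n0 : (0 < n)%N by exact: ltnW.
have [vp|vp] := eqVneq (v (pdiv n)%:R) 0; last first.
  by exists (pdiv n); rewrite // mem_primes pdiv_prime // n0 pdiv_dvd.
have /dvdnP[q nE] := pdiv_dvd n.
have n0K : n%:R != 0 :> K by apply: contraNneq vn => ->; rewrite place0.
have : (q%:R != 0 :> K) && ((pdiv n)%:R != 0 :> K).
  by rewrite -negb_or -mulf_eq0 -natrM -nE.
move=> /andP[q0 p0].
have vq : v q%:R != 0 by move: vn; rewrite {1}nE natrM placeM // vp addr0.
have q_lt : (q < n)%N.
  by rewrite nE ltn_Pmulr ?prime_gt1 ?pdiv_prime // lt0n; apply: contraNneq q0 => ->.
have [p] := IHm q (leq_trans q_lt n_le) vq.
rewrite !mem_primes => /and3P[pp _ pq] vp0; exists p => //.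
by rewrite mem_primes pp n0 nE dvdn_mulr.
Qed.

(** By a Bezout relation between [n] and [p], positive values at both would force a positive value
    at 1. *)
Lemma place_nat_coprime p n : 0 < v p%:R -> coprime n p -> v n%:R = 0.
Proof.
move=> vp; have [->|n0] := posnP n; first by rewrite place0.
have [a b ab _] := egcdnP p n0 => /eqP cop; rewrite cop in ab.
apply/eqP; apply: contraT => vn.
have n0K : n%:R != 0 :> K by apply: contraNneq vn => ->; rewrite place0.
have vn0 : 0 < v n%:R.
  by have := Ov_nat n; rewrite /in_Ov (negbTE n0K) /= lt_def vn.
have pos c k : 0 < v k%:R -> (c * k)%:R != 0 :> K -> 0 < v (c * k)%:R.
  move=> vk; rewrite natrM mulf_eq0 negb_or => /andP[c0 k0]; rewrite placeM //.
  by have := Ov_nat c; rewrite /in_Ov (negbTE c0) /=; lia.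
have e : 1%:R = (a * n)%:R + - (b * p)%:R :> K by rewrite ab natrD addrAC subrr add0r.
have := place_gtD 0 (a * n)%:R (- (b * p)%:R) (pos a n vn0).
rewrite -e placeN oppr_eq0 oner_neq0 place1 ltxx => /(_ (pos b p vp) isT); by [].
Qed.
End Place.

(** Discrete valuation rings are maximal subrings. Units for [v] are units for [w], so with [p] a
    uniformizer for [v] one gets [w = w p * v], where [w p] is nonnegative; since [w] takes the
    value 1, [w p] divides 1. *)
Lemma in_Ov_inj (K : fieldType) (v w : K -> int) :
  is_fin_place v -> is_fin_place w ->
  (forall a, in_Ov v a -> in_Ov w a) -> v = w.
Proof.
move=> hv hw sub; have [_ _ _ [p vp]] := hv.
have p0 : p != 0 by apply: contra_eq_neq vp => ->; rewrite place0.
have wu a : a != 0 -> v a = 0 -> w a = 0.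
  move=> a0 va; have := sub a; have := sub a^-1.
  rewrite /in_Ov invr_eq0 (negbTE a0) /= !placeV // va oppr0 => /(_ isT) + /(_ isT).
  lia.
have w_nat a n : a != 0 -> v a = n%:Z -> w a = w p *+ n.
  move=> a0 va; have q0 : a / p ^+ n != 0 by rewrite mulf_neq0 ?invr_eq0 ?expf_neq0.
  rewrite -[a](divfK (expf_neq0 n p0)) placeM ?expf_neq0 // placeX // wu ?add0r //.
  by rewrite placeM ?invr_eq0 ?expf_neq0 // placeV // placeX // vp va; lia.
have w_p a : w a = v a * w p.
  have [->|a0] := eqVneq a 0; first by rewrite !place0 // mul0r.
  case va: (v a) => [n|n]; first by rewrite (w_nat a n) // -mulr_natl natz.
  rewrite -[a]invrK placeV // (w_nat a^-1 n.+1) ?invr_eq0 //.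
    by rewrite NegzE mulNr -mulr_natl natz.
  by rewrite placeV // va NegzE opprK.
have wp0 : 0 <= w p.
  by have := sub p; rewrite /in_Ov (negbTE p0) vp => /(_ isT).
have [_ _ _ [q wq]] := hw; have wp1 : w p = 1.
  have : (w p %| 1)%Z by apply/dvdzP; exists (v q); rewrite -w_p.
  by rewrite dvdz1; lia.
by apply: functional_extensionality => a; rewrite w_p wp1 mulr1.
Qed.

(** By [in_Ov_inj] neither valuation ring contains the other; the quotient of an element of the
    first outside the second by one of the second outside the first separates the places. *)
Lemma place_separate (K : fieldType) (v w : K -> int) :
  is_fin_place v -> is_fin_place w -> v <> w ->
  exists x : K, [/\ x != 0, 0 < v x & w x < 0].
Proof.
have half (v1 v2 : K -> int) : is_fin_place v1 -> is_fin_place v2 -> v1 <> v2 ->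
    exists a, [/\ a != 0, 0 <= v1 a & v2 a < 0].
  move=> h1 h2 ne; apply: NNPP => none; apply: ne; apply: in_Ov_inj => // a.
  rewrite /in_Ov; have [//|a0 /= va] := eqVneq a 0.
  by rewrite leNgt; apply/negP => va2; apply: none; exists a.
move=> hv hw vw; have [a [a0 va wa]] := half v w hv hw vw.
have [b [b0 wb vb]] := half w v hw hv (nesym vw).
exists (a / b); rewrite mulf_neq0 ?invr_eq0 // !placeM ?invr_eq0 // !placeV //.
by split=> //; lia.
Qed.

(** Induction on [s]. If the element [z] found so far is not negative at the new place [k], a high
    power of an element [y] separating [i] from [k] is added to it. *)
Lemma place_separate_seq (K : fieldType) (I : eqType) (f : I -> K -> int) i (s : seq I) :
  injective f -> (forall j, is_fin_place (f j)) -> i \notin s ->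
  exists x : K, [/\ x != 0, 0 < f i x & forall j, j \in s -> f j x < 0].
Proof.
move=> f_inj hf; elim: s => [_|k s IHs].
  have [_ _ _ [x vx]] := hf i; exists x; split=> //; last by rewrite vx.
  by apply: contra_eq_neq vx => ->; rewrite place0.
rewrite inE negb_or => /andP[ik /IHs[z [z0 vz sz]]].
have [kz|kz] := ltrP (f k z) 0.
  by exists z; split=> // j; rewrite inE => /predU1P[->//|]; exact: sz.
have [|y [y0 vy ky]] := @place_separate _ (f i) (f k) (hf i) (hf k).
  by move=> /f_inj e; rewrite e eqxx in ik.
(* This exponent exceeds every [|f j z|]. Where [y] has negative value, [y ^+ r] therefore dominates
   [z]; where it does not, the negative value of [z] prevails. *)
pose r := (\sum_(j <- s) `|f j z|%N).+1.
have r_gt j : j \in s -> (`|f j z| < r)%N.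
  by move=> js; rewrite ltnS (big_rem j) //= leq_addr.
have yr0 : y ^+ r != 0 by rewrite expf_neq0.
have vyr j : f j (y ^+ r) = r%:Z * f j y by rewrite placeX // -mulr_natl natz.
have [s0 kE] : y ^+ r + z != 0 /\ f k (y ^+ r + z) = f k (y ^+ r).
  by apply: placeD_lt => // _; rewrite vyr; nia.
exists (y ^+ r + z); split=> //.
  by apply: place_gtD => //; rewrite vyr; nia.
move=> j; rewrite inE => /predU1P[->|js]; first by rewrite kE vyr; nia.
have := r_gt j js; have := sz j js => fz rz.
have [fy|fy] := lerP 0 (f j y).
  have [_ zE] : z + y ^+ r != 0 /\ f j (z + y ^+ r) = f j z.
    by apply: placeD_lt => // _; rewrite vyr; nia.
  by rewrite addrC zE.
have [_ yE] : y ^+ r + z != 0 /\ f j (y ^+ r + z) = f j (y ^+ r).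
  by apply: placeD_lt => // _; rewrite vyr; nia.
by rewrite yE vyr; nia.
Qed.

(** * Finiteness of places of a number field *)

Section NumberField.
Variable K : fieldExtType rat.
Implicit Types (v w : K -> int) (p : nat).

Lemma natK_eq0 n : (n%:R == 0 :> K) = (n == 0%N).
Proof. by rewrite -scaler_nat scaler_eq0 oner_eq0 orbF pnatr_eq0. Qed.

Lemma ratK q : q%:A = (numq q)%:~R / (denq q)%:~R :> K.
Proof. by rewrite -{1}[q]divq_num_den -in_algE fmorph_div !rmorph_int. Qed.

Lemma place_intP v (z : int) : is_fin_place v -> v z%:~R != 0 ->
  exists2 p, p \in primes `|z| & v p%:R != 0.
Proof.
move=> hv; case: z => n vz; first exact: place_natP.
by move: vz; rewrite NegzE abszN mulrNz placeN //; exact: place_natP.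
Qed.

Lemma place_ratP v q : is_fin_place v -> v q%:A != 0 ->
  exists2 p, p \in primes `|numq q| ++ primes `|denq q| & v p%:R != 0.
Proof.
move=> hv; have [->|q0 vq] := eqVneq q 0; first by rewrite scale0r place0 // eqxx.
have nd0 : (numq q)%:~R != 0 :> K /\ (denq q)%:~R != 0 :> K.
  by split; rewrite -(rmorph_int (in_alg K)) fmorph_eq0 intr_eq0 ?numq_eq0 ?denq_eq0.
move: vq; rewrite ratK placeM ?invr_eq0 ?nd0.1 ?nd0.2 // placeV // subr_eq0.
have [vn|/(place_intP _ _ hv)[p pn vp] _] := eqVneq (v (numq q)%:~R) 0; last first.
  by exists p; rewrite // mem_cat pn.
rewrite vn eq_sym => /(place_intP _ _ hv)[p pn vp].
by exists p; rewrite // mem_cat pn orbT.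
Qed.

(** The valuation ring of any place over [p] meets the rationals in the localization of the integers
    at [p]: integrality means that [p] does not divide the denominator. *)
Lemma Ov_rat_over p v w q : prime p -> is_fin_place v -> is_fin_place w ->
  0 < v p%:R -> 0 < w p%:R -> in_Ov v q%:A -> in_Ov w q%:A.
Proof.
move=> pp hv hw vp wp; have [->|q0] := eqVneq q 0; first by rewrite scale0r !Ov0.
have nd0 : (numq q)%:~R != 0 :> K /\ (denq q)%:~R != 0 :> K.
  by split; rewrite -(rmorph_int (in_alg K)) fmorph_eq0 intr_eq0 ?numq_eq0 ?denq_eq0.
have denE : (denq q)%:~R = `|denq q|%N%:R :> K.
  by rewrite -{1}(gez0_abs (denq_ge0 q)).
have [pd|pd] := boolP (p %| `|denq q|)%N; last first.
  move=> _; rewrite ratK OvM // ?Ov_int // Ov_eq0 // placeV // denE.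
  by rewrite (place_nat_coprime _ _ hw p) ?oppr0 // coprime_sym prime_coprime.
have pn : coprime `|numq q| p.
  have := coprime_num_den q; rewrite coprime_sym => /(coprime_dvdl pd).
  by rewrite coprime_sym.
have vn : v (numq q)%:~R = 0.
  case: (numq q) pn => n pn; first exact: place_nat_coprime hv p n vp pn.
  move: pn; rewrite NegzE abszN mulrNz placeN //.
  exact: place_nat_coprime hv p n.+1 vp.
have vd : 0 < v (denq q)%:~R.
  have /dvdnP[k kE] := pd; move: (nd0.2); rewrite denE kE natrM mulf_eq0 negb_or.
  case/andP=> k0 p0; rewrite placeM //; have := Ov_nat _ _ hv k.
  by rewrite /in_Ov (negbTE k0) /= => vk; exact: ltr_wpDl.
rewrite {1}/in_Ov ratK mulf_eq0 invr_eq0 (negbTE nd0.1) (negbTE nd0.2) /=.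
by rewrite placeM ?invr_eq0 ?nd0.1 ?nd0.2 // placeV // vn sub0r oppr_ge0 leNgt vd.
Qed.

Lemma places_over_prime_card p (I : finType) (f : I -> K -> int) : prime p ->
  injective f -> (forall i, is_fin_place (f i)) -> (forall i, 0 < f i p%:R) ->
  (#|I| <= \dim {:K})%N.
Proof.
move=> pp f_inj hf fp.
have sep i : exists x : K, [/\ x != 0, f i x < 0 & forall j, j != i -> 0 < f j x].
  (* The separating element is positive at [i] and negative elsewhere; its inverse has the required
     signs. *)
  have [|x [x0 vx sx]] := place_separate_seq K I f i (enum (predC1 i)) f_inj hf.
    by rewrite mem_enum inE eqxx.
  exists x^-1; rewrite invr_eq0; split=> //; first by rewrite placeV //; lia.
  by move=> j ji; rewrite placeV //; have := sx j; rewrite mem_enum inE => /(_ ji); lia.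
have [w hw] := fin_all_exists sep.
pose X := [tuple w (enum_val i) | i < #|I|].
suff fX : free X by rewrite -(size_tuple X) -(eqP fX) dimvS ?subvf.
apply/freeP => k sum0 i1; apply/eqP; apply: contraT => k1.
(* The minimum is taken at the single place [f (enum_val i1)]. [Ov_rat_over] carries the integrality
   of [k j / k i] over to [f (enum_val i)], whose normalization on the rationals may differ. *)
have [i ki min_i] := @arg_minP _ int _ i1 (fun i => k i != 0)
  (fun i => f (enum_val i1) (k i)%:A) k1.
have kA j : (k j)%:A == 0 :> K = (k j == 0) by rewrite scaler_eq0 oner_eq0 orbF.
have XE j : k j *: X`_j = (k j)%:A * w (enum_val j).
  by rewrite -tnth_nth tnth_mktuple mulr_algl.
suff : \sum_j k j *: X`_j != 0 by rewrite sum0 eqxx.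
have [wi0 vwi _] := hw (enum_val i).
apply: (@place_sum_neq0 _ (f (enum_val i)) (hf _) _ _ i).
  by rewrite XE mulf_neq0 ?kA.
move=> j ji; rewrite !XE mulf_eq0 kA negb_or => /andP[kj wj].
rewrite !placeM ?kA //.
have [_ _ /(_ (enum_val i))] := hw (enum_val j).
rewrite (inj_eq enum_val_inj) eq_sym ji => /(_ isT) vwj.
have : in_Ov (f (enum_val i)) (k j / k i)%:A.
  apply: (@Ov_rat_over p (f (enum_val i1))) => //.
  rewrite -in_algE fmorph_div /= /in_Ov mulf_eq0 invr_eq0 !kA (negbTE kj) (negbTE ki) /=.
  by rewrite placeM ?invr_eq0 ?kA // placeV // subr_ge0 min_i.
rewrite -in_algE fmorph_div /= /in_Ov mulf_eq0 invr_eq0 !kA (negbTE kj) (negbTE ki) /=.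
rewrite placeM ?invr_eq0 ?kA // placeV //; rewrite subr_ge0 => kij.
by apply: ler_ltD => //; exact: lt_trans vwi vwj.
Qed.

(** The list only has to cover the places satisfying [P]; it may contain others, so no decision
    procedure for [P] is required. *)
Definition finitely_many_places (P : (K -> int) -> Prop) : Prop :=
  exists S : seq (K -> int), (forall v, List.In v S -> is_fin_place v) /\
    forall v, is_fin_place v -> P v -> List.In v S.

Lemma finitely_many_sub (P Q : (K -> int) -> Prop) :
  (forall v, is_fin_place v -> P v -> Q v) ->
  finitely_many_places Q -> finitely_many_places P.
Proof.
by move=> PQ [S [hS SQ]]; exists S; split=> // v hv Pv; apply: SQ (PQ v hv Pv).
Qed.

Lemma finitely_many_or (P Q : (K -> int) -> Prop) :
  finitely_many_places P -> finitely_many_places Q ->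
  finitely_many_places (fun v => P v \/ Q v).
Proof.
move=> [S [hS SP]] [T [hT TQ]]; exists (List.app S T); split=> v.
  by case/(List.in_app_or S T v) => [/hS|/hT].
by move=> hv [/(SP v hv)|/(TQ v hv)] vS; apply: List.in_or_app; [left|right].
Qed.

Lemma finitely_many_has (I : eqType) (s : seq I) (P : I -> (K -> int) -> Prop) :
  (forall i, i \in s -> finitely_many_places (P i)) ->
  finitely_many_places (fun v => exists2 i, i \in s & P i v).
Proof.
elim: s => [_|i s IHs fP]; first by exists [::]; split=> // v _ [].
have fs : finitely_many_places (fun v => exists2 j, j \in s & P j v).
  by apply: IHs => j js; apply: fP; rewrite inE js orbT.
have fi := fP i (mem_head i s).
apply: finitely_many_sub (finitely_many_or _ _ fi fs) => v _ [j].
by rewrite inE => /predU1P[->|js] Pv; [left|right; exists j].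
Qed.

(** Were no finite list exhaustive, distinct places over [p] could be chosen one after another,
    beyond the bound given by the degree of [K]. *)
Lemma finitely_many_over_prime p : prime p ->
  finitely_many_places (fun v => 0 < v p%:R).
Proof.
move=> pp; apply: NNPP => inf.
suff fam m : exists f : 'I_m -> K -> int,
    [/\ injective f, forall i, is_fin_place (f i) & forall i, 0 < f i p%:R].
  have [f [f_inj hf fp]] := fam (\dim {:K}).+1.
  by have := places_over_prime_card p _ f pp f_inj hf fp; rewrite card_ord ltnn.
elim: m => [|m [f [f_inj hf fp]]].
  by exists (fun=> fun=> 0); split; case.
have [w [hw wp wf]] : exists w, [/\ is_fin_place w, 0 < w p%:R & forall i, f i <> w].
  apply: NNPP => none; apply: inf; exists [seq f i | i <- enum 'I_m]; split=> v.
    by case/List.in_map_iff => i [<- _].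
  move=> hv vp; apply: NNPP => vf; apply: none; exists v; split=> // i fi.
  apply: vf; apply/List.in_map_iff; exists i; split=> //.
  have := mem_enum 'I_m i; elim: (enum _) => //= j s IHs.
  by rewrite inE => /predU1P[->|/IHs]; [left|right].
exists (fun i => if unlift ord_max i is Some j then f j else w); split.
- move=> i j; case: unliftP => [i'|] ->; case: unliftP => [j'|] -> //.
  + by move/f_inj => ->.
  + by move/wf.
  + by move/esym/wf.
- by move=> i; case: unliftP.
- by move=> i; case: unliftP.
Qed.

Lemma finitely_many_rat (q : rat) : finitely_many_places (fun v => v q%:A != 0).
Proof.
apply: (@finitely_many_sub _ (fun v => exists2 p,
  p \in primes `|numq q| ++ primes `|denq q| & 0 < v p%:R)).
  move=> v hv /(place_ratP _ _ hv)[p pq vp]; exists p => //.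
  move: vp (Ov_nat _ _ hv p); rewrite /in_Ov natK_eq0.
  have -> : (p == 0)%N = false.
    by move: pq; rewrite mem_cat !mem_primes; case: p.
  by rewrite /= lt_def => -> ->.
apply: finitely_many_has => p; rewrite mem_cat !mem_primes => pq.
by apply: finitely_many_over_prime; case/orP: pq => /andP[].
Qed.

(** The powers of [a] up to the degree of [K] satisfy a rational relation. If all its coefficients
    have value 0 at [v] but [a] does not, its nonzero terms have distinct values, which is
    impossible. The support of [a] thus lies in that of finitely many rationals. *)
Lemma finitely_many_support (a : K) : finitely_many_places (fun v => v a != 0).
Proof.
pose m := (\dim {:K}).+1.
pose X := [tuple a ^+ i | i < m].
have nfX : ~~ free X.
  apply/negP => fX; have : (size X <= \dim {:K})%N by rewrite -(eqP fX) dimvS ?subvf.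
  by rewrite size_tuple ltnn.
have [k [sum0 k0]] : exists k : 'I_m -> rat, \sum_i k i *: X`_i = 0 /\ exists i, k i != 0.
  apply: NNPP => none; case/negP: nfX; apply/freeP => k sum0 i; apply/eqP.
  by apply: contraT => ki; case: none; exists k; split=> //; exists i.
have XE i : k i *: X`_i = (k i)%:A * a ^+ i.
  by rewrite -tnth_nth tnth_mktuple mulr_algl.
have kA j : (k j)%:A == 0 :> K = (k j == 0) by rewrite scaler_eq0 oner_eq0 orbF.
apply: (@finitely_many_sub _ (fun v => exists2 i, i \in enum 'I_m & v (k i)%:A != 0)).
  move=> v hv va; apply: NNPP => none.
  have vk i : v (k i)%:A = 0.
    by apply/eqP; apply: contraT => vki; case: none; exists i; rewrite ?mem_enum.
  have a0 : a != 0 by apply: contraNneq va => ->; rewrite place0.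
  have [i1 ki1] := k0.
  have [i ki min_i] := @arg_minP _ int _ i1 (fun i => k i != 0) (fun i => v (a ^+ i)) ki1.
  suff : \sum_j k j *: X`_j != 0 by rewrite sum0 eqxx.
  apply: (@place_sum_neq0 _ v hv _ _ i); first by rewrite XE mulf_neq0 ?kA ?expf_neq0.
  move=> j ji; rewrite !XE mulf_eq0 negb_or kA => /andP[kj _].
  rewrite !placeM ?kA ?expf_neq0 // !vk !add0r lt_def min_i // andbT.
  have vX n : v (a ^+ n) = n%:Z * v a by rewrite placeX // -mulr_natl natz.
  rewrite !vX; apply: contraNneq ji => /(mulIf va)[e].
  by apply/eqP/val_inj.
by apply: finitely_many_has => i _; apply: finitely_many_rat.
Qed.
End NumberField.

(** * Zeros of multivariate polynomials *)

Lemma poly_eq0_of_zeros (R : idomainType) (p : {poly R}) (u : nat -> R) :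
  injective u -> (forall k, p.[u k] = 0) -> p = 0.
Proof.
move=> u_inj pu; apply/eqP; apply: contraT => p0.
have := @max_poly_roots _ p [seq u k | k <- iota 0 (size p)] p0.
rewrite map_inj_uniq // iota_uniq size_map size_iota ltnn => -> //.
by apply/allP => _ /mapP[k _ ->]; apply/rootP.
Qed.

Lemma horner_mmap_polyC (R : comNzRingType) N (h : 'I_N -> {poly R}) (p : {mpoly R[N]}) s :
  (mmap polyC h p).[s] = p.@[fun i => (h i).[s]].
Proof.
rewrite /mmap mevalE horner_sum; apply: eq_bigr => m _.
rewrite hornerM hornerC /mmap1 horner_prod; congr (_ * _).
by apply: eq_bigr => i _; rewrite horner_exp.
Qed.

(** On the line, [p] becomes a polynomial in one variable with infinitely many roots. *)
Lemma mpoly_vanish_line (R : idomainType) N (p : {mpoly R[N]}) (x d : 'I_N -> R) (u : nat -> R) :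
  injective u -> (forall k, p.@[fun i => x i + u k * d i] = 0) ->
  forall s, p.@[fun i => x i + s * d i] = 0.
Proof.
move=> u_inj pu s; pose P := mmap polyC (fun i => (x i)%:P + d i *: 'X) p.
have PE r : P.[r] = p.@[fun i => x i + r * d i].
  by rewrite horner_mmap_polyC; apply: meval_eq => i; rewrite !hornerE mulrC.
by rewrite -PE (poly_eq0_of_zeros _ P u) ?horner0 // => k; rewrite PE.
Qed.

Lemma digits_inj D N (f g : 'I_N -> nat) :
  (forall i, f i < D)%N -> (forall i, g i < D)%N ->
  (\sum_i f i * D ^ i = \sum_i g i * D ^ i)%N -> f =1 g.
Proof.
elim: N f g => [|N IHN] f g fD gD; first by move=> _ [].
have shift (h : 'I_N.+1 -> nat) :
    (\sum_i h i * D ^ i = (\sum_(i < N) h (lift ord0 i) * D ^ i) * D + h ord0)%N.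
  rewrite big_ord_recl muln1 addnC big_distrl; congr addn.
  by apply: eq_bigr => i _; rewrite /= expnSr mulnA.
have D0 : (0 < D)%N by exact: leq_trans (fD ord0).
rewrite !shift => e.
have e0 : f ord0 = g ord0.
  by have := congr1 (modn^~ D) e; rewrite !modnMDl !modn_small.
have e1 := congr1 (divn^~ D) e.
rewrite /= !divnMDl // !divn_small // !addn0 in e1.
have eL := IHN _ _ (fun i => fD (lift ord0 i)) (fun i => gD (lift ord0 i)) e1.
by move=> i; case: (unliftP ord0 i) => [j|] ->; [exact: eL|exact: e0].
Qed.

(* Kronecker's substitution X_i := X^(D^i) keeps distinct monomials distinct. *)
Lemma mpoly_eq0_of_vanish (R : idomainType) N (p : {mpoly R[N]}) (u : nat -> R) :
  injective u -> (forall x : 'I_N -> R, p.@[x] = 0) -> p = 0.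
Proof.
(* For nonzero [p], [msize] is the degree plus one, so every exponent occurring in [p] is a digit in
   base [D]. *)
move=> u_inj px; pose D := msize p.
pose e (m : 'X_{1..N}) := (\sum_i m i * D ^ i)%N.
pose P := mmap polyC (fun i : 'I_N => 'X^(D ^ i)) p.
have P0 : P = 0 by apply: (poly_eq0_of_zeros _ P u u_inj) => k; rewrite horner_mmap_polyC.
have PE : P = \sum_(m <- msupp p) p@_m *: 'X^(e m).
  apply: eq_bigr => m _; rewrite mul_polyC; congr (_ *: _).
  by rewrite /mmap1 /e expr_sum; apply: eq_bigr => i _; rewrite -exprM mulnC.
have m_lt (m : 'X_{1..N}) (i : 'I_N) : m \in msupp p -> (m i < D)%N.
  move=> mp; apply: leq_ltn_trans (msize_mdeg_lt mp).
  by rewrite mdegE (bigD1 i) //= leq_addr.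
apply/mpolyP => m; rewrite mcoeff0; apply/eqP; apply: contraT => pm.
have mp : m \in msupp p by rewrite mcoeff_msupp.
have := congr1 (fun q : {poly R} => q`_(e m)) P0.
rewrite PE coef0 coef_sum (bigD1_seq m) ?msupp_uniq //= big1_seq => [|m' /andP[m'm m'p]].
  by rewrite coefZ coefXn eqxx mulr1 addr0 => pm0; rewrite pm0 eqxx in pm.
rewrite coefZ coefXn; have [em|] := eqVneq (e m) (e m'); last by rewrite mulr0.
case/eqP: m'm; apply/mnmP => i.
by apply: (digits_inj D N m' m) => [j|j|]; [exact: m_lt|exact: m_lt|].
Qed.

(** * Integral points and the divisor *)

Lemma dhomog_meval_scale (R : comNzRingType) N (p : {mpoly R[N]}) d (c : R) (x : 'I_N -> R) :
  p \is d.-homog -> p.@[fun i => c * x i] = c ^+ d * p.@[x].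
Proof.
move=> /dhomogP hp; rewrite !mevalE big_distrr; apply: eq_big_seq => m /hp /= <-.
rewrite mulrCA; congr (_ * _); rewrite mdegE expr_sum -big_split.
by apply: eq_bigr => i _; rewrite exprMn.
Qed.

Lemma divisor_eq_homogeneous (K : fieldType) k N (H : 'M[K]_(k, N)) (A : 'M[K]_N) :
  homogeneous (divisor_eq H A).
Proof.
have Xh (i : 'I_N) : ('X_i : {mpoly K[N]}) \is 1.-homog by rewrite dhomogX /= mdeg1.
exists (\sum_(i < k) 1 + 2)%N; apply: dhomogM.
  elim/big_rec2: _ => [|i d p _ hp]; first exact: dhomog1.
  apply: dhomogM => //; apply: rpred_sum => j _; exact: rpredZ.
apply: rpred_sum => i _; apply: rpred_sum => j _; apply: rpredZ.
exact: (dhomogM (d := 1) (e := 1)).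
Qed.

(** Normalized coordinates [c * x] have one outside the maximal ideal, and [x] is integral, so
    [v c <= 0]. Then [F] at [c * x] is [c ^+ d] times a unit and has value at most 0, although [F]
    itself is an integral element of the radical ideal. *)
Lemma integral_pointI (K : fieldType) N (S : seq (K -> int)) (F : {mpoly K[N]})
    (x : 'I_N -> K) :
  homogeneous F -> nonzero_pt x -> F.@[x] != 0 ->
  (forall v, is_fin_place v -> ~ List.In v S ->
    [/\ forall i, in_Ov v (x i), forall m, in_Ov v F@_m & v F.@[x] = 0]) ->
  integral_point S F x.
Proof.
move=> [d hF] x0 Fx0 good; split=> // v hv vS [c [c0 _ [i ci] redF]].
have [Ox OF vF] := good v hv vS.
have FF : in_rad F F by exists 1%N, 1; rewrite expr1 mulr1.
have := redF F FF (ex_intro _ d hF) OF.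
rewrite (dhomog_meval_scale _ _ _ d) // /in_mv mulf_eq0 expf_eq0 (negbTE c0) andbF.
rewrite (negbTE Fx0) /= placeM ?expf_neq0 // placeX // vF addr0.
apply/negP; rewrite -leNgt; apply: mulrn_wle0.
move: ci; rewrite /in_mv mulf_eq0 (negbTE c0) /= negb_or => /andP[xi0].
rewrite -leNgt placeM //; apply: le_trans; rewrite lerDl.
by have := Ox i; rewrite /in_Ov (negbTE xi0).
Qed.

(** * The quadratic form and adapted coordinates *)

Section Forms.
Variables (K : fieldType) (N : nat) (A : 'M[K]_N).
Implicit Types x y z : 'cV[K]_N.

Definition bform x y : K := (x^T *m A *m y) 0 0.

Lemma bformDl x y z : bform (x + y) z = bform x z + bform y z.
Proof. by rewrite /bform linearD /= !mulmxDl mxE. Qed.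

Lemma bformDr x y z : bform z (x + y) = bform z x + bform z y.
Proof. by rewrite /bform !mulmxDr mxE. Qed.

Lemma bformZl c x y : bform (c *: x) y = c * bform x y.
Proof. by rewrite /bform linearZ /= -!scalemxAl mxE. Qed.

Lemma bformZr c x y : bform y (c *: x) = c * bform y x.
Proof. by rewrite /bform -!scalemxAr mxE. Qed.

Lemma bformC x y : A^T = A -> bform x y = bform y x.
Proof.
move=> AT; rewrite /bform.
have -> : y^T *m A *m x = (x^T *m A *m y)^T by rewrite !trmx_mul trmxK AT mulmxA.
by rewrite [RHS]mxE.
Qed.

Lemma meval_quadform x : (quadform A).@[fun i => x i 0] = bform x x.
Proof.
rewrite /quadform /bform raddf_sum /= mxE.
under eq_bigr do rewrite raddf_sum /=.
rewrite exchange_big; apply: eq_bigr => j _; rewrite mxE big_distrl.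
apply: eq_bigr => i _; rewrite mevalZ mevalM !mevalXU mxE /=; ring.
Qed.

Lemma meval_linform k (H : 'M[K]_(k, N)) i x :
  (linform H i).@[fun i => x i 0] = (H *m x) i 0.
Proof.
rewrite /linform raddf_sum mxE; apply: eq_bigr => j _.
by rewrite /= mevalZ mevalXU.
Qed.

Lemma meval_divisor_eq k (H : 'M[K]_(k, N)) x :
  (divisor_eq H A).@[fun i => x i 0] = (\prod_i (H *m x) i 0) * bform x x.
Proof.
rewrite /divisor_eq mevalM meval_quadform rmorph_prod; congr (_ * _).
by apply: eq_bigr => i _; exact: meval_linform.
Qed.

(* Coordinates in which the hyperplanes are t_i = 0 and the quadric is q(t) + 2b yz = 0. *)
Lemma adapted_coordinates k (H : 'M[K]_(k, N)) :
  (2 : K) != 0 -> row_free H -> A^T = A ->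
  (exists P1 P2 : 'I_N -> K,
    [/\ nonzero_pt P1 /\ nonzero_pt P2, ~ proportional P1 P2,
        on_LQ H A P1, on_LQ H A P2
      & forall P, nonzero_pt P -> on_LQ H A P ->
          proportional P P1 \/ proportional P P2]) ->
  exists (E : 'M[K]_(N, k)) (p1 p2 : 'cV[K]_N) (b : K),
    [/\ b != 0,
        forall (t : 'cV[K]_k) (y z : K), H *m (E *m t + y *: p1 + z *: p2) = t,
        forall (t : 'cV[K]_k) (y z : K) (x := E *m t + y *: p1 + z *: p2),
          bform x x = bform (E *m t) (E *m t) + 2 * b * y * z
      & forall x, exists (t : 'cV[K]_k) (y z : K), x = E *m t + y *: p1 + z *: p2].
Proof.
move=> two0 hH AT [P1 [P2 [[nz1 nz2] np12 L1 L2 uniqLQ]]].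
pose p1 : 'cV[K]_N := \col_i P1 i; pose p2 : 'cV[K]_N := \col_i P2 i.
have nzE (x : 'cV[K]_N) : x != 0 -> nonzero_pt (fun i => x i 0).
  move=> x0; apply: NNPP => none; case/eqP: x0; apply/matrixP => i j; rewrite ord1 mxE.
  by apply/eqP; apply: contraT => xi; case: none; exists i.
have LQE P : on_LQ H A P <-> H *m (\col_i P i) = 0 /\ bform (\col_i P i) (\col_i P i) = 0.
  have eP : (fun i => (\col_i P i) i 0) =1 P by move=> i; rewrite mxE.
  rewrite -meval_quadform (meval_eq _ eP); split=> [[lP qP]|[lP qP]]; split=> //.
    apply/matrixP => i j; rewrite ord1 -meval_linform (meval_eq _ eP) lP mxE //.
  by move=> i; rewrite -(meval_eq _ eP) meval_linform lP mxE.
have [H1 q1] := (LQE P1).1 L1; have [H2 q2] := (LQE P2).1 L2.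
rewrite -/p1 in H1 q1; rewrite -/p2 in H2 q2.
have colE (x : 'cV[K]_N) : \col_i x i 0 = x by apply/matrixP => i j; rewrite ord1 mxE.
(* Vector form of the hypothesis on the line: an isotropic vector in the kernel of [H] is a multiple
   of [p1] or of [p2]. *)
have uniq_p (x : 'cV[K]_N) : H *m x = 0 -> bform x x = 0 ->
    exists c d, x = c *: p1 + d *: p2 /\ (c = 0 \/ d = 0).
  move=> Hx qx; have [->|x0] := eqVneq x 0.
    by exists 0, 0; rewrite !scale0r addr0; split=> //; left.
  have [|[c xc]|[c xc]] := uniqLQ (fun i => x i 0) (nzE x x0).
  - by apply/LQE; rewrite colE.
  - exists c, 0; split; last by right.
    by apply/matrixP => i j; rewrite ord1 !mxE xc mul0r addr0.
  - exists 0, c; split; last by left.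
    by apply/matrixP => i j; rewrite ord1 !mxE xc mul0r add0r.
have free_p c d : c *: p1 + d *: p2 = 0 -> c = 0 /\ d = 0.
  move=> cd0; have cdE i : c * P1 i + d * P2 i = 0.
    by have := congr1 (fun x : 'cV[K]_N => x i 0) cd0; rewrite !mxE.
  have c0 : c = 0.
    apply/eqP; apply: contraT => c0; case: np12; exists (- d / c) => i.
    by apply: (mulfI c0); apply/eqP; rewrite -subr_eq0 -(cdE i); apply/eqP; field.
  split=> //; apply/eqP; apply: contraT => d0; case: nz2 => i; case/negP.
  by have := cdE i; rewrite c0 mul0r add0r => /eqP; rewrite mulf_eq0 (negbTE d0).
pose b := bform p1 p2.
have b0 : b != 0.
  (* If [b] vanished, [p1 + p2] would be a third point of the line on the quadric. *)
  apply/eqP => bE; have [||c [d [pE cd]]] := uniq_p (p1 + p2).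
  - by rewrite mulmxDr H1 H2 addr0.
  - by rewrite !bformDl !bformDr q1 q2 (bformC p2) // -/b bE !addr0.
  have [] := free_p (1 - c) (1 - d).
    rewrite !scalerBl !scale1r addrACA pE -opprD subrr //.
  move=> /eqP; rewrite subr_eq0 => /eqP c1 /eqP; rewrite subr_eq0 => /eqP d1.
  by case: cd => e; move: (oner_neq0 K); [rewrite c1|rewrite d1]; rewrite e eqxx.
have [E0 HE0] : exists E0 : 'M_(N, k), H *m E0 = 1%:M.
  by exists (pinvmx H); exact: mulmxVp.
(* The right inverse [E0] of [H] is corrected so that its image is orthogonal to [p1] and [p2]; the
   corrections lie in the kernel of [H], so [E] is still a right inverse. *)
pose E := E0 - b^-1 *: (p2 *m (p1^T *m A *m E0)) - b^-1 *: (p1 *m (p2^T *m A *m E0)).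
have HE (t : 'cV[K]_k) : H *m (E *m t) = t.
  rewrite mulmxA /E !mulmxBr -!scalemxAr !mulmxA H1 H2 !mul0mx !scaler0 !subr0.
  by rewrite HE0 mul1mx.
have Et (t : 'cV[K]_k) : E *m t = E0 *m t - (b^-1 * bform p1 (E0 *m t)) *: p2
                     - (b^-1 * bform p2 (E0 *m t)) *: p1.
  have rk1 (p q : 'cV[K]_N) : (p *m (q^T *m A *m E0)) *m t = bform q (E0 *m t) *: p.
    rewrite -mulmxA -[_ *m t]mulmxA /bform.
    by rewrite {1}[_ *m (E0 *m t)]mx11_scalar mul_mx_scalar.
  by rewrite /E !mulmxBl -!scalemxAl !rk1 !scalerA.
have B1 (t : 'cV[K]_k) : bform p1 (E *m t) = 0.
  rewrite Et -!scaleNr !bformDr !bformZr q1 -/b; field; exact: b0.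
have B2 (t : 'cV[K]_k) : bform p2 (E *m t) = 0.
  rewrite Et -!scaleNr !bformDr !bformZr q2 (bformC p2 p1) // -/b; field; exact: b0.
exists E, p1, p2, b; split=> //.
- by move=> t y z; rewrite !mulmxDr HE -!scalemxAr H1 H2 !scaler0 !addr0.
- move=> t y z /=; rewrite !bformDl !bformDr !bformZl !bformZr q1 q2 B1 B2.
  rewrite (bformC (E *m t) p1) // (bformC (E *m t) p2) // B1 B2 (bformC p2 p1) // -/b.
  ring.
move=> x; pose y : K := bform p2 x / b; pose z : K := bform p1 x / b.
exists (H *m x), y, z; set t := H *m x.
(* The remainder [x'] lies in the kernel of [H] and is orthogonal to [p1] and [p2]; it has to be
   shown to vanish. *)
have [x' x'_def] : exists x', x' = x - E *m t - y *: p1 - z *: p2 by eexists.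
have Hx' : H *m x' = 0.
  by rewrite x'_def !mulmxBr HE -!scalemxAr H1 H2 !scaler0 !subr0 subrr.
have b1 : bform p1 x' = 0.
  rewrite x'_def -!scaleNr !bformDr -scaleN1r !bformZr q1 B1 -/b /z; field; exact: b0.
have b2 : bform p2 x' = 0.
  rewrite x'_def -!scaleNr !bformDr -scaleN1r !bformZr q2 B2 (bformC p2 p1) // -/b /y.
  by field; exact: b0.
(* This [r] makes [x' + p1 + r *: p2] isotropic. By [uniq_p] it lies in the span of [p1] and [p2],
   hence so does [x'], and orthogonality to both makes [x'] zero. This replaces a dimension count
   for the kernel of [H]. *)
pose r := - bform x' x' / (2 * b).
have [||c [d [xE _]]] := uniq_p (x' + p1 + r *: p2).
- by rewrite !mulmxDr Hx' H1 -scalemxAr H2 scaler0 !addr0.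
- rewrite !bformDl !bformDr !bformZl !bformZr q1 q2 b1 b2.
  rewrite (bformC x' p1) // (bformC x' p2) // b1 b2 (bformC p2 p1) // -/b /r.
  by field; rewrite two0 b0.
have x'E : x' = (c - 1) *: p1 + (d - r) *: p2.
  rewrite !scalerBl scale1r addrACA -xE -opprD -[x' + p1 + _]addrA addrK //.
have := b1; have := b2; rewrite x'E !bformDr !bformZr q1 q2 (bformC p2 p1) // -/b.
rewrite !mulr0 addr0 add0r => /eqP; rewrite mulf_eq0 (negbTE b0) orbF => /eqP c1.
move=> /eqP; rewrite mulf_eq0 (negbTE b0) orbF => /eqP dr.
have x'0 : x' = 0 by rewrite x'E c1 dr !scale0r addr0.
by apply/eqP; rewrite -subr_eq0 !opprD !addrA -x'_def x'0.
Qed.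
End Forms.

(** * Zariski density of the constructed points *)

Section Density.
Variables (K : fieldType) (N k : nat) (p : {mpoly K[N]}) (u : nat -> K).
Hypothesis u_inj : injective u.

Local Notation vanishes x := (p.@[fun i => x i 0] = 0).

Lemma mpoly_vanish_col_line (x d : 'cV[K]_N) (w : nat -> K) : injective w ->
  (forall l, vanishes (x + w l *: d)) -> forall s, vanishes (x + s *: d).
Proof.
have lineE s : p.@[fun i => (x + s *: d) i 0] = p.@[fun i => x i 0 + s * d i 0].
  by apply: meval_eq => i; rewrite !mxE.
move=> w_inj pw s; rewrite lineE; apply: mpoly_vanish_line w_inj _ s => l.
by rewrite -lineE.
Qed.

(** The coefficient of [p2] is the solution [z] of [q t + c * y * z = u l] with [y = u m]. The
    parameters are freed one at a time, each along a line with infinitely many known zeros: first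
    [z], then [y], then the entries of [t]. *)
Lemma mpoly_vanish_span (E : 'M[K]_(N, k)) (p1 p2 : 'cV[K]_N) (c : K) (q : 'cV[K]_k -> K) :
  c != 0 -> (forall l, u l != 0) ->
  (forall (t : 'cV[K]_k) m l, (forall i, exists e, t i 0 = u e) ->
     vanishes (E *m t + u m *: p1 + ((u l - q t) / (c * u m)) *: p2)) ->
  forall (t : 'cV[K]_k) y z, vanishes (E *m t + y *: p1 + z *: p2).
Proof.
move=> c0 u0 p_pts.
have step0 (t : 'cV[K]_k) y z : (forall i, exists e, t i 0 = u e) ->
    vanishes (E *m t + y *: p1 + z *: p2).
  move=> tu; rewrite addrAC; apply: (mpoly_vanish_col_line _ _ u) => // m.
  rewrite addrAC.
  apply: (mpoly_vanish_col_line _ _ (fun l => (u l - q t) / (c * u m))) => [l l'|l].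
    by move/(mulIf (invr_neq0 (mulf_neq0 c0 (u0 m))))/addIr/u_inj.
  exact: p_pts.
(* The entries of [t] with index below [j] are already arbitrary; those from [j] on are still values
   of [u]. *)
suff steps j (t : 'cV[K]_k) y z : (forall i : 'I_k, j <= i -> exists e, t i ord0 = u e)%N ->
    vanishes (E *m t + y *: p1 + z *: p2).
  by move=> t y z; apply: (steps k) => i; rewrite leqNgt ltn_ord.
elim: j t y z => [|j IHj] t y z tu; first by apply: step0 => i; exact: tu.
have [jk|kj] := ltnP j k; last first.
  by apply: IHj => i ji; have := leq_ltn_trans (leq_trans kj ji) (ltn_ord i); rewrite ltnn.
(* [t0] is [t] with entry [j] set to zero, so that [t0 + u l *: d] has the value [u l] there. *)
pose i0 := Ordinal jk; pose d : 'cV[K]_k := delta_mx i0 0; pose t0 := t - t i0 0 *: d.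
have lineE s : E *m (t0 + s *: d) + y *: p1 + z *: p2
             = E *m t0 + y *: p1 + z *: p2 + s *: (E *m d).
  by rewrite mulmxDr -scalemxAr (addrAC (E *m t0)) (addrAC (E *m t0 + y *: p1)).
have tE : t = t0 + t i0 0 *: d by rewrite /t0 subrK.
rewrite {1}tE lineE; apply: (mpoly_vanish_col_line _ _ u) => // l.
rewrite -lineE; apply: IHj => i; rewrite leq_eqVlt => /predU1P[ji|ji].
  have -> : i = i0 by apply/val_inj.
  by exists l; rewrite !mxE !eqxx mulr1 subrr add0r mulr1.
have [e te] := tu i ji; exists e.
have -> : (t0 + u l *: d) i 0 = t i 0; last by [].
have ii0 : (i == i0) = false by apply/negbTE; rewrite -val_eqE /= gtn_eqF.
by rewrite !mxE ii0 !mulr0 subr0 addr0.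
Qed.
End Density.

(** * Integral points of the complement and their density *)

Lemma Ov_mulmx (K : fieldType) (v : K -> int) m n r (B : 'M[K]_(m, n)) (C : 'M[K]_(n, r)) :
  is_fin_place v -> (forall i j, in_Ov v (B i j)) -> (forall i j, in_Ov v (C i j)) ->
  forall i j, in_Ov v ((B *m C) i j).
Proof. by move=> hv OB OC i j; rewrite mxE; apply: Ov_sum => // l; exact: OvM. Qed.

Lemma expr2_inj (K : fieldExtType rat) : injective (fun l => 2 ^+ l : K).
Proof.
move=> l m; rewrite -!natrX => e; apply: (@expnI 2) => //; apply/eqP.
by rewrite -(eqr_nat rat) -(inj_eq (fmorph_inj (in_alg K))) !rmorph_nat e.
Qed.

Theorem theorem1p1 (n : nat) (hn : (2 <= n)%N) (K : fieldExtType rat)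
    (S : seq (K -> int)) (hS : forall v, List.In v S -> is_fin_place v)
    (H : 'M[K]_(n.-1, n.+1)) (hH : row_free H)
    (A : 'M[K]_(n.+1)) (hAsym : A^T = A) (hAsmooth : \det A != 0)
    (hLQ : exists P1 P2 : 'I_n.+1 -> K,
        [/\ nonzero_pt P1 /\ nonzero_pt P2, ~ proportional P1 P2,
            on_LQ H A P1, on_LQ H A P2
          & forall P, nonzero_pt P -> on_LQ H A P ->
              proportional P P1 \/ proportional P P2]) :
  potentially_dense S (divisor_eq H A).
Proof.
have two0 : (2 : K) != 0 by rewrite natK_eq0.
have [E [p1 [p2 [b [b0 HE qE span]]]]] := adapted_coordinates K _ A _ H two0 hH hAsym hLQ.
pose F := divisor_eq H A.
pose entries m r (B : 'M[K]_(m, r)) := [seq B ij.1 ij.2 | ij <- enum {: 'I_m * 'I_r}].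
(* Outside the enlarged set [S'] all of these have value 0: the coefficients of the divisor and the
   matrix entries become integral, while 2 and [b] become units. *)
pose bad := [seq F@_m | m <- msupp F] ++ [:: 2; b]
  ++ entries _ _ E ++ entries _ _ p1 ++ entries _ _ p2 ++ entries _ _ A.
have [T [hT badT]] : finitely_many_places K (fun v => exists2 a, a \in bad & v a != 0).
  by apply: finitely_many_has => a _; exact: finitely_many_support.
pose S' : seq (K -> int) := List.app S T.
have good v a : is_fin_place v -> ~ List.In v S' -> a \in bad -> v a = 0.
  move=> hv vS' a_bad; apply/eqP; apply: contraT => va; case: vS'.
  by apply: List.in_or_app; right; apply: badT => //; exists a.
have entries_Ov m r (B : 'M[K]_(m, r)) v : is_fin_place v -> ~ List.In v S' ->
    {subset entries _ _ B <= bad} -> forall i j, in_Ov v (B i j).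
  move=> hv vS' sB i j; apply/Ov_eq0/(good v _ hv vS')/sB/mapP.
  by exists (i, j); rewrite ?mem_enum.
(* Only the set of places is enlarged; the field stays [K]. *)
exists K, idfun, S'; split.
- by move=> w /(List.in_app_or S T)[/hS|/hT].
- move=> w hw [v vS vw]; apply: List.in_or_app; left.
  (* Over the same field, lying above means having the same valuation ring, hence being the same
     place. *)
  rewrite -(in_Ov_inj _ v w) //; first exact: hS.
  by move=> a; rewrite vw.
have -> : map_mpoly idfun (divisor_eq H A) = F.
  by apply/mpolyP => m; rewrite mcoeff_map_mpoly.
move=> g _ g_pts; apply: (mpoly_eq0_of_vanish _ _ g _ (expr2_inj K)) => x.
have -> : g.@[x] = g.@[fun i => (\col_i x i) i 0].
  by apply: meval_eq => i; rewrite mxE.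
have [t [y [z ->]]] := span (\col_i x i).
apply: (mpoly_vanish_span K _ _ g _ (expr2_inj K) E p1 p2 (2 * b)
  (fun t => bform K _ A (E *m t) (E *m t))) => [||{x y z} {}t m l tu].
- by rewrite mulf_neq0.
- by move=> l; rewrite expf_neq0.
set z := _ / _; set X := _ + _; apply: g_pts.
(* By the choice of [z] the quadric takes the value [2 ^+ l] at [X], so the equation of the divisor
   evaluates to a product of powers of 2. *)
have qX : bform K _ A X X = 2 ^+ l.
  by rewrite qE /z; field; rewrite two0 b0 expf_neq0.
have FX : F.@[fun i => X i 0] = (\prod_i t i 0) * 2 ^+ l.
  by rewrite meval_divisor_eq qX HE.
have t0 i : t i 0 != 0 by have [e ->] := tu i; rewrite expf_neq0.
have prod0 : \prod_i t i 0 != 0 by apply/prodf_neq0.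
apply: integral_pointI.
- exact: divisor_eq_homogeneous.
- apply: NNPP => X0; have : bform K _ A X X != 0 by rewrite qX expf_neq0.
  case/negP; suff -> : X = 0 by rewrite /bform mulmx0 mxE.
  apply/matrixP => i j; rewrite ord1 [RHS]mxE; apply/eqP; apply: contraT => Xi.
  by case: X0; exists i.
- by rewrite FX mulf_neq0 ?expf_neq0.
move=> v hv vS'.
have v2 e : v (2 ^+ e) = 0.
  by rewrite placeX // (good v 2) ?mul0rn // !mem_cat !inE eqxx !orbT.
have vt i : v (t i 0) = 0 by have [e ->] := tu i; exact: v2.
have OE i j : in_Ov v (E i j).
  by apply: (entries_Ov _ _ E) => // a aE; rewrite !mem_cat aE !orbT.
have O1 i j : in_Ov v (p1 i j).
  by apply: (entries_Ov _ _ p1) => // a ap; rewrite !mem_cat ap !orbT.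
have O2 i j : in_Ov v (p2 i j).
  by apply: (entries_Ov _ _ p2) => // a ap; rewrite !mem_cat ap !orbT.
have OA i j : in_Ov v (A i j).
  by apply: (entries_Ov _ _ A) => // a aA; rewrite !mem_cat aA !orbT.
have Et : forall i j, in_Ov v ((E *m t) i j).
  by apply: Ov_mulmx => // i j; rewrite ord1 Ov_eq0.
(* The denominator [2 * b * 2 ^+ m] is a unit at [v], and the numerator is integral because [A], [E]
   and [t] are. *)
have Oz : in_Ov v z.
  have vb : v b = 0 by rewrite (good v b) // !mem_cat !inE eqxx !orbT.
  have v21 : v 2 = 0 by have := v2 1%N.
  apply: OvM => //; last first.
    by apply: Ov_eq0; rewrite placeV // !placeM ?mulf_neq0 ?expf_neq0 // v21 vb v2.
  apply: OvD => //; first exact/Ov_eq0/v2.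
  rewrite OvN //; apply: Ov_mulmx => //; apply: Ov_mulmx => // i j.
  by rewrite mxE.
split.
- move=> i; have -> : X i 0 = (E *m t) i 0 + 2 ^+ m * p1 i 0 + z * p2 i 0 by rewrite !mxE.
  by apply: OvD; [|apply: OvD|apply: OvM] => //; apply: OvM => //; exact/Ov_eq0/v2.
- move=> m'; have [mF|mF] := boolP (m' \in msupp F).
    by apply/Ov_eq0/good; rewrite // mem_cat; apply/orP; left; apply/mapP; exists m'.
  by rewrite memN_msupp_eq0 // Ov0.
rewrite FX placeM ?expf_neq0 // v2 addr0.
suff : \prod_i t i 0 != 0 /\ v (\prod_i t i 0) = 0 by case.
apply: (big_ind (fun a => a != 0 /\ v a = 0)) => [|a c [a0 va] [c0 vc]|i _] //.
- by rewrite oner_neq0 place1.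
- by rewrite mulf_neq0 // placeM // va vc.
Qed.
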